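(* Let $Q\subset\mathbb{R}^n$ be a convex compact set, and let the field $g:Q\to\mathbb{R}^n$ satisfy $$\|g(x)-g(y)\|_*\leqslant L\|x-y\|\qquad\forall x,y\in Q.$$ Then the adaptive proximal mirror method (Algorithm 1, described in the context) with accuracy $\varepsilon>0$ works for at most $$\left\lceil\frac{2LR^2}{\varepsilon}\right\rceil$$ iterations. If one chooses $L^0\leqslant 2L$, then $$\max_{x\in Q}\ \min_{k=0,\dots,N-1}\left\langle g(y^{k+1}),\,y^{k+1}-x\right\rangle\leqslant\frac{1}{S_N}\max_{x\in Q}\sum_{k=0}^{N-1}\frac{1}{L^{k+1}}\left\langle g(y^{k+1}),\,y^{k+1}-x\right\rangle\leqslant\varepsilon,$$ where $N$ is the number of iterations performed before stopping, $y^1,\dots,y^N$ and $L^1,\dots,L^N$ are the points and constants produced by the method, and $S_N=\sum_{k=0}^{N-1}\frac{1}{L^{k+1}}$.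
   Context: $\mathbb{R}^n$ is equipped with a norm $\|\cdot\|$ (in general not Euclidean), $\|\cdot\|_*$ is the dual norm, and $\langle\cdot,\cdot\rangle$ is the scalar product on $\mathbb{R}^n$. A function $d$ is given which is $1$-strongly convex with respect to $\|\cdot\|$ and differentiable at all points of $Q$. The corresponding Bregman divergence is $$V(x,y)=d(x)-d(y)-\langle\nabla d(y),x-y\rangle,\qquad x,y\in Q.$$ Algorithm 1 (adaptive proximal mirror method). Input: accuracy $\varepsilon>0$, initial constant $L^0>0$, starting point $x^0=\arg\min_{x\in Q}d(x)$. Put $R^2=\max_{x\in Q}V(x,x^0)$. For $k=0,1,2,\dots$ the iteration passing from $x^k$ to $x^{k+1}$ is as follows. 1. Set $L^{k+1}:=L^k/2$. 2. Compute $$y^{k+1}:=\arg\min_{x\in Q}\left\{\langle g(x^k),x-x^k\rangle+L^{k+1}V(x,x^k)\right\},$$ $$x^{k+1}:=\arg\min_{x\in Q}\left\{\langle g(y^{k+1}),x-x^k\rangle+L^{k+1}V(x,x^k)\right\}.$$ 3. If $$\langle g(y^{k+1})-g(x^k),\,y^{k+1}-x^{k+1}\rangle\leqslant L^{k+1}V(y^{k+1},x^k)+L^{k+1}V(x^{k+1},y^{k+1}),$$ pass to the next iteration (step 1). 4. Otherwise double the constant, $L^{k+1}:=2L^{k+1}$, and return to step 2. 5. Stopping criterion: the method stops after $N$ iterations once $\sum_{k=0}^{N-1}\frac{1}{L^{k+1}}\geqslant\frac{R^2}{\varepsilon}$. An iteration is one passage from $x^k$ to $x^{k+1}$; repeated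 executions of step 2 within it are not counted separately.
   Formalization: The bound on the number of iterations is proved only for L^0 ≤ 2L (it fails for large L^0, e.g. g = 0 with L^0 = 100); termination is proved for every L^0 > 0, and the displayed inequalities are stated for N ≥ 1, since for N = 0 they are undefined. *)

(* Defs.v *)
From mathcomp Require Import all_boot all_order all_algebra.
From mathcomp Require Import all_classical all_reals all_analysis.

Set Implicit Arguments.
Unset Strict Implicit.
Unset Printing Implicit Defensive.

Import Order.TTheory GRing.Theory Num.Theory.
Import numFieldNormedType.Exports.

Local Open Scope classical_set_scope.
Local Open Scope ring_scope.

(* R^n is 'rV[R]_n. Its built-in (max) norm only provides the topology used by
   [compact] and [differentiable]; the norm of the setting is an arbitrary
   function nu satisfying [is_norm]. *)
Record is_norm (R : realType) (n : nat) (nu : 'rV[R]_n -> R) : Prop := IsNorm {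
  is_norm_triangle : forall x y, nu (x + y) <= nu x + nu y;
  is_norm_scale : forall (a : R) x, nu (a *: x) = `|a| * nu x;
  is_norm_definite : forall x, nu x = 0 -> x = 0
}.

Definition dotp (R : realType) (n : nat) (x y : 'rV[R]_n) : R :=
  \sum_(i < n) x 0 i * y 0 i.

Definition dual_norm (R : realType) (n : nat) (nu : 'rV[R]_n -> R)
    (s : 'rV[R]_n) : R :=
  sup [set dotp s x | x in [set x | nu x <= 1]].

Definition strongly_convex (R : realType) (n : nat) (mu : R)
    (nu : 'rV[R]_n -> R) (Q : set 'rV[R]_n) (d : 'rV[R]_n -> R) : Prop :=
  forall (x y : 'rV[R]_n) (t : R), Q x -> Q y -> 0 <= t -> t <= 1 ->
    d (t *: x + (1 - t) *: y) <=
      t * d x + (1 - t) * d y - mu / 2 * (t * (1 - t)) * nu (x - y) ^+ 2.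

Definition gradient (R : realType) (n : nat) (d : 'rV[R]_n -> R)
    (x : 'rV[R]_n) : 'rV[R]_n :=
  \row_(i < n) ('D_(delta_mx 0 i) d x : R).

Definition bregman (R : realType) (n : nat) (d : 'rV[R]_n -> R)
    (x y : 'rV[R]_n) : R :=
  d x - d y - dotp (gradient d y) (x - y).

Definition is_argmin_on (R : realType) (T : Type) (Q : set T) (f : T -> R)
    (x : T) : Prop :=
  Q x /\ forall z, Q z -> f x <= f z.

(* m is the maximum of f on Q, attained. *)
Definition is_max_on (R : realType) (T : Type) (Q : set T) (f : T -> R)
    (m : R) : Prop :=
  (f @` Q `&` ubound (f @` Q)) m.

(* Minimum of f 0, ..., f (N - 1), for 0 < N: the default value f 0 is then one
   of the terms. *)
Definition min_below (R : realType) (N : nat) (f : nat -> R) : R :=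
  \big[Num.min/f 0%N]_(k < N) f k.

Definition prox_step (R : realType) (n : nat) (Q : set 'rV[R]_n)
    (d : 'rV[R]_n -> R) (g : 'rV[R]_n -> 'rV[R]_n) (xk : 'rV[R]_n) (Lc : R)
    (y x : 'rV[R]_n) : Prop :=
  is_argmin_on Q (fun z => dotp (g xk) (z - xk) + Lc * bregman d z xk) y /\
  is_argmin_on Q (fun z => dotp (g y) (z - xk) + Lc * bregman d z xk) x.

Definition accepted (R : realType) (n : nat) (d : 'rV[R]_n -> R)
    (g : 'rV[R]_n -> 'rV[R]_n) (xk : 'rV[R]_n) (Lc : R) (y x : 'rV[R]_n) :
    Prop :=
  dotp (g y - g xk) (y - x) <= Lc * bregman d y xk + Lc * bregman d x y.

(* One iteration from (xk, Lk) to (x, Lc), with intermediate point y: the trial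
   constants are Lk / 2, 2 (Lk / 2), 4 (Lk / 2), ..., and Lc is the first one
   whose trial passes the test, here after m doublings. *)
Definition apm_iteration (R : realType) (n : nat) (Q : set 'rV[R]_n)
    (d : 'rV[R]_n -> R) (g : 'rV[R]_n -> 'rV[R]_n)
    (xk : 'rV[R]_n) (Lk : R) (y x : 'rV[R]_n) (Lc : R) : Prop :=
  exists m : nat,
    [/\ Lc = 2 ^+ m * (Lk / 2),
        prox_step Q d g xk Lc y x,
        accepted d g xk Lc y x &
        forall j : nat, (j < m)%N ->
          exists u v : 'rV[R]_n,
            prox_step Q d g xk (2 ^+ j * (Lk / 2)) u v /\
            ~ accepted d g xk (2 ^+ j * (Lk / 2)) u v].

Definition inv_sum (R : realType) (Lc : nat -> R) (N : nat) : R :=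
  \sum_(k < N) (Lc k.+1)^-1.

(* The method has performed N iterations, none of them after the stopping
   criterion was met; R2 is the number R^2. Only x 0, ..., x N, y 1, ..., y N
   and Lc 0, ..., Lc N are constrained. *)
Record apm_run (R : realType) (n : nat) (Q : set 'rV[R]_n)
    (d : 'rV[R]_n -> R) (g : 'rV[R]_n -> 'rV[R]_n)
    (eps L0 : R) (x0 : 'rV[R]_n) (R2 : R) (N : nat)
    (x y : nat -> 'rV[R]_n) (Lc : nat -> R) : Prop := ApmRun {
  apm_run_x0 : x 0%N = x0;
  apm_run_L0 : Lc 0%N = L0;
  apm_run_iter : forall k : nat, (k < N)%N ->
    apm_iteration Q d g (x k) (Lc k) (y k.+1) (x k.+1) (Lc k.+1);
  apm_run_not_stopped : forall k : nat, (k < N)%N -> inv_sum Lc k < R2 / eps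
}.

(* A run of exactly N iterations after which the method stops. *)
Definition apm_complete_run (R : realType) (n : nat) (Q : set 'rV[R]_n)
    (d : 'rV[R]_n -> R) (g : 'rV[R]_n -> 'rV[R]_n)
    (eps L0 : R) (x0 : 'rV[R]_n) (R2 : R) (N : nat)
    (x y : nat -> 'rV[R]_n) (Lc : nat -> R) : Prop :=
  apm_run Q d g eps L0 x0 R2 N x y Lc /\ R2 / eps <= inv_sum Lc N.

(* Main.v *)
Require Import Defs.
From mathcomp Require Import all_boot all_order all_algebra.
From mathcomp Require Import all_classical all_reals all_analysis.
From mathcomp Require Import ring lra.

Set Implicit Arguments.
Unset Strict Implicit.
Unset Printing Implicit Defensive.

Import Order.TTheory GRing.Theory Num.Theory.
Import numFieldNormedType.Exports.

Local Open Scope classical_set_scope.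
Local Open Scope ring_scope.

(** Why the theorem holds.  Put [V = bregman d].  Two facts drive everything.

    Strong convexity gives [1/2 nu (x - y)^2 <= V x y] ([bregman_ge]).  With the
    Lipschitz bound and [a b <= (a^2 + b^2) / 2], every trial constant that is
    at least [L] passes the acceptance test ([accepted_of_ge]).  So the doubling
    loop terminates, and an accepted constant that was reached by doubling is
    less than [2 L], because half of it was rejected.  The constants therefore
    stay below [M = max (L0, 2 L)], hence [inv_sum Lc k >= k / M]
    ([inv_sum_ge]).  The stopping criterion is eventually met, and when
    [L0 <= 2 L], so that [M = 2 L], at most [ceil (2 L R2 / eps)] iterations are
    made: before the last one the sum was still less than [R2 / eps].

    First-order optimality of a proximal point and the three-point identity of
    the Bregman divergence give [prox_ineq].  Adding its instances for the two
    proximal steps of an iteration to the acceptance test cancels all the terms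
    except
    [ (Lc k.+1)^-1 * <g (y k.+1), y k.+1 - z> <= V z (x k) - V z (x k.+1) ]
    ([apm_iteration_ineq]).  The sum over [k] telescopes to at most
    [V z x0 <= R2] ([regret_le]), and the stopping criterion says that [R2] is
    at most [eps] times the sum of the weights.  The bound on the minimum holds
    because a minimum is at most a weighted mean.

    The existence of proximal points and of the two maxima is the extreme value
    theorem on the compact set [Q].  The Lipschitz hypothesis is stated with the
    dual norm; the generalized Cauchy-Schwarz inequality [dotp_le_dual_norm]
    that makes it usable relies on the equivalence of norms in finite dimension
    ([norm_le_is_norm]). *)

(** * The scalar product, arbitrary norms and their duals *)

Section ScalarProduct.
Context {R : realType} {n : nat}.
Implicit Types (x y z s : 'rV[R]_n).

Lemma dotpC x y : dotp x y = dotp y x.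
Proof. by apply: eq_bigr => i _; rewrite mulrC. Qed.

Lemma dotpDr s x y : dotp s (x + y) = dotp s x + dotp s y.
Proof.
by rewrite /dotp -big_split; apply: eq_bigr => i _; rewrite mxE mulrDr.
Qed.

Lemma dotpZr s (a : R) x : dotp s (a *: x) = a * dotp s x.
Proof.
by rewrite /dotp mulr_sumr; apply: eq_bigr => i _; rewrite mxE mulrCA.
Qed.

Lemma dotpNr s x : dotp s (- x) = - dotp s x.
Proof. by rewrite -scaleN1r dotpZr mulN1r. Qed.

Lemma dotpBr s x y : dotp s (x - y) = dotp s x - dotp s y.
Proof. by rewrite dotpDr dotpNr. Qed.

Lemma dotpBl x y s : dotp (x - y) s = dotp x s - dotp y s.
Proof. by rewrite dotpC dotpBr !(dotpC s). Qed.

Lemma ler_coord_norm x i : `|x 0 i| <= `|x|.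
Proof.
rewrite [leRHS]/Num.norm /= mx_normrE; apply/bigmax_geP; right => /=.
by exists (0, i).
Qed.

Lemma ler_dotp_norm s x : dotp s x <= (\sum_i `|s 0 i|) * `|x|.
Proof.
apply: le_trans (ler_norm _) _.
rewrite mulr_suml; apply: le_trans (ler_norm_sum _ _ _) _.
by apply: ler_sum => i _; rewrite normrM ler_wpM2l// ler_coord_norm.
Qed.

Lemma differentiable_dotp s x : differentiable (dotp s) x.
Proof.
rewrite (_ : dotp s = \sum_(i < n) (s 0 i *: (fun y : 'rV[R]_n => y 0 i))).
  apply: differentiable_sum => i; apply: differentiableZ.
  exact: differentiable_coord.
by apply/funext => y; rewrite fct_sumE.
Qed.

Lemma differentiable_dotpB s a x : differentiable (fun z => dotp s (a - z)) x.
Proof.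
rewrite (_ : (fun z => _) = cst (dotp s a) - dotp s).
  by apply: differentiableB; [exact: differentiable_cst|
                              exact: differentiable_dotp].
by apply/funext => z; rewrite dotpBr.
Qed.

End ScalarProduct.

Section Norm.
Context {R : realType} {n : nat} {nu : 'rV[R]_n -> R} (nu_norm : is_norm nu).
Implicit Types (x y s : 'rV[R]_n).

Lemma is_norm0 : nu 0 = 0.
Proof. by rewrite -(scale0r 0) (is_norm_scale nu_norm) normr0 mul0r. Qed.

Lemma is_normN x : nu (- x) = nu x.
Proof. by rewrite -scaleN1r (is_norm_scale nu_norm) normrN1 mul1r. Qed.

Lemma is_norm_ge0 x : 0 <= nu x.
Proof.
by have := is_norm_triangle nu_norm x (- x); rewrite subrr is_norm0 is_normN; lra.
Qed.

Lemma is_norm_le_norm x : nu x <= (\sum_i nu (delta_mx 0 i)) * `|x|.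
Proof.
rewrite {1}(row_sum_delta x).
have nu_sum (I : Type) (r : seq I) (F : I -> 'rV[R]_n) :
    nu (\sum_(i <- r) F i) <= \sum_(i <- r) nu (F i).
  elim/big_rec2: _ => [|i a v _ le_va]; first by rewrite is_norm0.
  by apply: le_trans (is_norm_triangle nu_norm _ _) _; rewrite lerD2l.
apply: le_trans (nu_sum _ _ _) _; rewrite mulr_suml; apply: ler_sum => i _.
by rewrite (is_norm_scale nu_norm) mulrC ler_wpM2l ?is_norm_ge0 ?ler_coord_norm.
Qed.

Lemma is_norm_continuous : continuous nu.
Proof.
have sub_le x y : nu x - nu y <= nu (x - y).
  by have := is_norm_triangle nu_norm (x - y) y; rewrite subrK; lra.
set K := \sum_i nu (delta_mx 0 i).
have K_ge0 : 0 <= K by apply: sumr_ge0 => i _; exact: is_norm_ge0.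
move=> x; apply/(@cvgrPdist_le _ _ _ _ (nbhs_filter x)) => e e_gt0.
apply/(@nbhs_normP R 'rV[R]_n x).
exists (e / (K + 1)) => /=; first by rewrite divr_gt0//; lra.
move=> y /=; rewrite ltr_pdivlMr => [lt_e|]; last by lra.
apply: (@le_trans _ _ (K * `|x - y|)).
  apply: le_trans (is_norm_le_norm _).
  rewrite ler_norml sub_le andbT lerNl opprB.
  by apply: le_trans (sub_le _ _) _; rewrite -is_normN opprB.
by apply: le_trans (ltW lt_e); rewrite mulrC ler_wpM2l// lerDl.
Qed.

(** [nu] is continuous and positive on the unit sphere of the built-in norm,
    which is compact; the constant is the inverse of its minimum there. *)
Lemma norm_le_is_norm : exists C : R, forall x, `|x| <= C * nu x.
Proof.
pose S := [set x : 'rV[R]_n | `|x| = 1].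
have [S0|/set0P/negP] := pselect (S !=set0); last first.
  (* The sphere is empty only in dimension 0, where every vector is 0. *)
  rewrite negbK => /eqP S0; exists 0 => x; rewrite mul0r.
  have [->|x0] := eqVneq x 0; first by rewrite normr0.
  have : S (`|x|^-1 *: x) by rewrite /S /= normrZ normfV normr_id mulVf ?normr_eq0.
  by rewrite S0.
have cS : compact S.
  apply: bounded_closed_compact.
    by exists 1; split; [exact: num_real | move=> M M1 x /= ->; exact: ltW].
  rewrite (_ : S = (fun x => `|x|) @^-1` [set 1])//.
  apply: closed_comp; last exact: closed_eq.
  by move=> x _; exact: norm_continuous.
have [c cS1 cmin] := EVT_min_rV S0 cS (continuous_subspaceT is_norm_continuous).
have c_gt0 : 0 < nu c.
  rewrite lt_neqAle is_norm_ge0 andbT eq_sym; apply/eqP => /(is_norm_definite nu_norm) c0.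
  by move: cS1; rewrite inE /S /= c0 normr0 => /eqP; rewrite eq_sym oner_eq0.
exists (nu c)^-1 => x.
have [->|x0] := eqVneq x 0; first by rewrite normr0 is_norm0 mulr0.
have : S (`|x|^-1 *: x) by rewrite /S /= normrZ normfV normr_id mulVf ?normr_eq0.
move=> /mem_set /cmin; rewrite (is_norm_scale nu_norm) normfV normr_id.
by rewrite ler_pdivlMl ?normr_gt0// ler_pdivlMl// mulrC.
Qed.

(** The supremum that defines the dual norm is taken over a set that is bounded
    because [nu] dominates the built-in norm; without this bound [sup] would
    return a default value. *)
Lemma dotp_le_dual_norm s x : dotp s x <= dual_norm nu s * nu x.
Proof.
have [C leC] := norm_le_is_norm.
have ubd : has_ubound [set dotp s u | u in [set u | nu u <= 1]].
  exists ((\sum_i `|s 0 i|) * `|C|) => _ [u /= u1 <-].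
  apply: le_trans (ler_dotp_norm _ _) _.
  rewrite ler_wpM2l ?sumr_ge0//.
  apply: le_trans (leC _) _; apply: le_trans (ler_norm _) _.
  by rewrite normrM ler_piMr// ger0_norm ?is_norm_ge0.
have [->|x0] := eqVneq x 0.
  by rewrite is_norm0 mulr0 /dotp big1// => i _; rewrite mxE mulr0.
have nux_gt0 : 0 < nu x.
  rewrite lt_neqAle is_norm_ge0 andbT eq_sym.
  by apply: contra_neq x0; exact: is_norm_definite.
rewrite -ler_pdivrMr// mulrC -dotpZr.
apply: ub_le_sup => //; exists ((nu x)^-1 *: x) => //=.
by rewrite (is_norm_scale nu_norm) normfV gtr0_norm// mulVf// gt_eqF.
Qed.

End Norm.

(** * Gradients, Bregman divergences and proximal points *)

Section Gradient.
Context {R : realType} {n : nat}.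
Implicit Types (d : 'rV[R]_n -> R) (a v x y z : 'rV[R]_n).

Lemma derive_gradient d a v :
  differentiable d a -> 'D_v d a = dotp (gradient d a) v.
Proof.
move=> da; rewrite deriveE// {1}(row_sum_delta v) linear_sum.
by apply: eq_bigr => i _; rewrite linearZ /= mxE deriveE// mulrC.
Qed.

(** Divide by [t] and let [t] tend to 0 from the right.  The second-order term
    makes room for the modulus of strong convexity, and [0 < t <= 1] is the range
    in which convexity keeps [a + t *: v] in the domain. *)
Lemma ge_dotp_gradient d a v (c e : R) : differentiable d a ->
  (forall t, 0 < t -> t <= 1 ->
     t * c - t ^+ 2 * e <= d (a + t *: v) - d a) ->
  c <= dotp (gradient d a) v.
Proof.
move=> da le_d; rewrite -derive_gradient//.
have dv : (fun h : R => h^-1 *: ((d \o shift a) (h *: v) - d a) + h * e)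
            @ 0^'+ --> 'D_v d a + 0 * e.
  apply: cvgD; first by apply: cvg_dnbhs_at_right; exact: (diff_derivable da).
  apply: cvgM; last exact: cvg_cst.
  by apply: cvg_at_right_filter; exact: cvg_id.
rewrite mul0r addr0 in dv; apply: cvgr_to_ge dv _.
near=> t; have t_gt0 : 0 < t by near: t; exact: nbhs_right_gt.
have t_le1 : t <= 1 by near: t; apply: nbhs_right_ltW.
rewrite /GRing.scale /= -lerBlDr ler_pdivlMl// (addrC _ a).
by have := le_d t t_gt0 t_le1; lra.
Unshelve. all: by end_near. Qed.

Lemma le_dotp_gradient d a v (c e : R) : differentiable d a ->
  (forall t, 0 < t -> t <= 1 ->
     d (a + t *: v) - d a <= t * c + t ^+ 2 * e) ->
  dotp (gradient d a) v <= c.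
Proof.
move=> da d_le; rewrite -derive_gradient// -lerN2 -deriveN; last exact: diff_derivable.
have dNa : differentiable (- d) a by exact: differentiableN.
rewrite derive_gradient//; apply: (ge_dotp_gradient (e := e)) => // t t_gt0 t_le1.
by have := d_le t t_gt0 t_le1; rewrite /= !fctE; lra.
Qed.

Lemma bregman_three_points d z y a :
  bregman d z a - bregman d z y - bregman d y a =
  dotp (gradient d y - gradient d a) (z - y).
Proof. by rewrite /bregman dotpBl !dotpBr; ring. Qed.

Lemma convex_set_segment (Q : set 'rV[R]_n) x y (t : R) :
  convex_set Q -> Q x -> Q y -> 0 <= t -> t <= 1 -> Q (y + t *: (x - y)).
Proof.
move=> cQ Qx Qy t0 t1.
have := cQ x y (Itv01 t0 t1) (mem_set Qx) (mem_set Qy); rewrite inE.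
rewrite /conv /= /unstable.onem scalerBl scale1r scalerBr.
by rewrite addrCA.
Qed.

(** The strong convexity inequality at [y + t *: (x - y)] reads
    [d (y + t *: (x - y)) - d y <= t * (d x - d y - h) + t^2 * h] with
    [h = 1/2 nu (x - y)^2]; [h] is therefore also the second-order constant. *)
Lemma bregman_ge nu (Q : set 'rV[R]_n) d x y :
  strongly_convex 1 nu Q d -> differentiable d y -> Q x -> Q y ->
  1 / 2 * nu (x - y) ^+ 2 <= bregman d x y.
Proof.
move=> scd dy Qx Qy; rewrite /bregman lerBrDr -lerBrDl.
apply: (le_dotp_gradient (e := 1 / 2 * nu (x - y) ^+ 2)) => // t t0 t1.
have := scd x y t Qx Qy (ltW t0) t1.
have -> : t *: x + (1 - t) *: y = y + t *: (x - y).
  by rewrite scalerBl scale1r scalerBr addrCA.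
by nra.
Qed.

Lemma continuous_prox_objective s a (c : R) d z : differentiable d z ->
  {for z, continuous (fun z => dotp s (z - a) + c * bregman d z a)}.
Proof.
move=> dz; apply: differentiable_continuous.
pose K := c * (dotp (gradient d a) a - d a) - dotp s a.
rewrite (_ : (fun z => _) =
    dotp s + c *: (d - dotp (gradient d a)) + cst K); last first.
  apply/funext => w; rewrite /bregman !dotpBr /K !fctE /cst /GRing.scale /=.
  by ring.
apply: differentiableD; last exact: differentiable_cst.
apply: differentiableD; first exact: differentiable_dotp.
apply: differentiableZ; apply: differentiableB => //.
exact: differentiable_dotp.
Qed.

Lemma argmin_exists (Q : set 'rV[R]_n) (f : 'rV[R]_n -> R) :
  Q !=set0 -> compact Q -> (forall z, Q z -> {for z, continuous f}) ->
  exists y, is_argmin_on Q f y.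
Proof.
move=> Q0 cQ cf.
have [|y /set_mem Qy miny] := EVT_min_rV Q0 cQ (f := f).
  by apply: continuous_in_subspaceT => z /set_mem; exact: cf.
by exists y; split => // z Qz; apply: miny; exact: mem_set.
Qed.

Lemma max_exists (Q : set 'rV[R]_n) (f : 'rV[R]_n -> R) :
  Q !=set0 -> compact Q -> continuous f -> exists m, is_max_on Q f m.
Proof.
move=> Q0 cQ cf.
have [y /set_mem Qy maxy] := EVT_max_rV Q0 cQ (continuous_subspaceT cf).
exists (f y); split; first by exists y.
by move=> _ [z Qz <-]; apply: maxy; exact: mem_set.
Qed.

(** Moving from the minimizer [y] towards [z] does not decrease the objective,
    whose slope at [y] is [<s + c (grad d y - grad d a), z - y>]; the
    three-point identity rewrites the gradient part. *)
Lemma prox_ineq (Q : set 'rV[R]_n) d s a (c : R) y z :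
  convex_set Q -> differentiable d y -> 0 < c ->
  is_argmin_on Q (fun z => dotp s (z - a) + c * bregman d z a) y -> Q z ->
  dotp s (y - z) <= c * (bregman d z a - bregman d z y - bregman d y a).
Proof.
move=> cQ dy c_gt0 [Qy miny] Qz; rewrite bregman_three_points.
suff : dotp (gradient d a) (z - y) - c^-1 * dotp s (z - y) <=
       dotp (gradient d y) (z - y).
  rewrite lerBlDr -lerBlDl ler_pdivlMl// dotpBl.
  by rewrite !(dotpBr s); lra.
apply: (ge_dotp_gradient (e := 0)) => // t t0 t1.
have := miny _ (convex_set_segment cQ Qz Qy (ltW t0) t1).
rewrite /bregman !dotpBr !dotpDr !dotpZr !dotpBr.
set p := dotp s z; set q := dotp s y.
move=> le0; rewrite -(ler_pM2l c_gt0) mulr0 subr0.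
have -> : c * (t * (dotp (gradient d a) z - dotp (gradient d a) y -
    c^-1 * (p - q))) =
  c * (t * (dotp (gradient d a) z - dotp (gradient d a) y)) - t * (p - q).
  by field; lra.
by move: le0; lra.
Qed.
End Gradient.

(** * The adaptive method *)

Lemma continuous_min_below (R : realType) (n N : nat)
    (F : nat -> 'rV[R]_n -> R) :
  (forall k, continuous (F k)) -> continuous (fun z => min_below N (F ^~ z)).
Proof.
move=> cF z; rewrite /min_below; elim: (index_enum _) => [|i r IHr].
  rewrite (_ : (fun z => _) = F 0%N); first exact: cF.
  by apply/funext => w; rewrite big_nil.
rewrite (_ : (fun z => _) =
    F i \min (fun z => \big[Num.min/F 0%N z]_(k <- r) F k z)).
  by apply: continuous_min => //; exact: cF.
by apply/funext => w; rewrite big_cons.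
Qed.

Section Method.
Context {R : realType} {n : nat} {nu : 'rV[R]_n -> R} {Q : set 'rV[R]_n}
  {d : 'rV[R]_n -> R} {g : 'rV[R]_n -> 'rV[R]_n} {L : R}
  (nu_norm : is_norm nu) (Q_convex : convex_set Q) (Q_compact : compact Q)
  (d_strongly_convex : strongly_convex 1 nu Q d)
  (d_differentiable : forall x, Q x -> differentiable d x)
  (g_lipschitz : forall x y, Q x -> Q y ->
     dual_norm nu (g x - g y) <= L * nu (x - y)).
Implicit Types (x y : nat -> 'rV[R]_n) (Lc : nat -> R).

Lemma bregman_ge0 u v : Q u -> Q v -> 0 <= bregman d u v.
Proof.
move=> Qu Qv; have dv := d_differentiable Qv.
apply: le_trans (bregman_ge d_strongly_convex dv Qu Qv).
by rewrite mulr_ge0 ?sqr_ge0.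
Qed.

(** The left-hand side of the test is at most
    [c nu (u - xk) nu (u - v) <= c / 2 (nu (u - xk)^2 + nu (u - v)^2)]. *)
Lemma accepted_of_ge xk (c : R) u v :
  Q xk -> Q u -> Q v -> 0 < c -> L <= c -> accepted d g xk c u v.
Proof.
move=> Qxk Qu Qv c_gt0 leLc.
have lu := bregman_ge d_strongly_convex (d_differentiable Qxk) Qu Qxk.
have lv := bregman_ge d_strongly_convex (d_differentiable Qu) Qv Qu.
rewrite -(is_normN nu_norm) opprB in lv.
have a_ge0 := is_norm_ge0 nu_norm (u - xk).
have b_ge0 := is_norm_ge0 nu_norm (u - v).
rewrite /accepted; apply: le_trans (dotp_le_dual_norm nu_norm _ _) _.
set a := nu (u - xk) in lu a_ge0 *; set b := nu (u - v) in lv b_ge0 *.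
apply: (@le_trans _ _ (c * a * b)).
  rewrite ler_wpM2r//; apply: le_trans (g_lipschitz Qu Qxk) _.
  by rewrite ler_wpM2r.
rewrite -mulrDr -mulrA ler_pM2l//; apply: le_trans (lerD lu lv).
by have := sqr_ge0 (a - b); rewrite sqrrB; lra.
Qed.

Lemma prox_step_exists xk (c : R) :
  Q xk -> exists u v, prox_step Q d g xk c u v.
Proof.
move=> Qxk.
have Q0 : Q !=set0 by exists xk.
have argmin_obj s : exists w,
    is_argmin_on Q (fun z => dotp s (z - xk) + c * bregman d z xk) w.
  apply: argmin_exists => // z Qz; apply: continuous_prox_objective.
  exact: d_differentiable.
have [u minu] := argmin_obj (g xk); have [v minv] := argmin_obj (g u).
by exists u, v.
Qed.

Lemma apm_iteration_exists xk (Lk : R) : Q xk -> 0 < Lk ->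
  exists u v (c : R), apm_iteration Q d g xk Lk u v c.
Proof.
move=> Qxk Lk_gt0; pose c (j : nat) : R := 2 ^+ j * (Lk / 2).
have c_gt0 j : 0 < c j by rewrite mulr_gt0 ?exprn_gt0//; lra.
have [u /choice[v uvP]] := choice (fun j => prox_step_exists (c j) Qxk).
have ex_acc : exists j, `[< accepted d g xk (c j) (u j) (v j) >].
  (* [2 ^ j > j] makes this [j] large enough for [L <= c j]. *)
  exists (Num.bound `|L / (Lk / 2)|); apply/asboolP; apply: accepted_of_ge => //.
  - by have [[Qu _] _] := uvP (Num.bound `|L / (Lk / 2)|).
  - by have [_ [Qv _]] := uvP (Num.bound `|L / (Lk / 2)|).
  rewrite -ler_pdivrMr; last by lra.
  apply: le_trans (ler_norm _) _.
  apply: le_trans (ltW (archi_boundP (normr_ge0 _))) _.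
  rewrite -natrX ler_nat; exact: ltnW (ltn_expl _ (ltnSn 1)).
case: (ex_minnP ex_acc) => m /asboolP acc_m min_m.
exists (u m), (v m), (c m), m; split => // j lt_jm.
exists (u j), (v j); split; first exact: uvP.
move=> /asboolP /min_m.
by rewrite leqNgt lt_jm.
Qed.

(** If the constant was doubled, its half failed the test, hence is less than
    [L]. *)
Lemma apm_iterationP xk (Lk : R) u v (c : R) :
  Q xk -> 0 < Lk -> apm_iteration Q d g xk Lk u v c ->
  [/\ Q v, 0 < c & c = Lk / 2 \/ c < 2 * L].
Proof.
move=> Qxk Lk_gt0 [m [-> [[Qu _] [Qv _]] _ rej]].
split => //; first by rewrite mulr_gt0 ?exprn_gt0//; lra.
case: m rej => [_|m rej]; [by left; rewrite expr0 mul1r|right].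
have [u' [v' [[[Qu' _] [Qv' _]] nacc]]] := rej m (ltnSn m).
rewrite exprS -mulrA ltr_pM2l// ltNge; apply/negP => leLc; apply: nacc.
by apply: accepted_of_ge => //; rewrite mulr_gt0 ?exprn_gt0//; lra.
Qed.

(** Split [u - z] as [(u - v) + (v - z)].  The second proximal step bounds
    [<g u, v - z>], the first one bounds [<g xk, u - v>], and the acceptance test
    bounds the error [<g u - g xk, u - v>] made by using [g xk] there. *)
Lemma apm_iteration_ineq xk (Lk : R) u v (c : R) z :
  Q xk -> 0 < Lk -> apm_iteration Q d g xk Lk u v c -> Q z ->
  c^-1 * dotp (g u) (u - z) <= bregman d z xk - bregman d z v.
Proof.
move=> Qxk Lk_gt0 it Qz; have [_ c_gt0 _] := apm_iterationP Qxk Lk_gt0 it.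
have [_ [_ [minu minv] acc _]] := it.
have [[Qu _] [Qv _]] := (minu, minv).
rewrite ler_pdivrMl//.
have := prox_ineq Q_convex (d_differentiable Qv) c_gt0 minv Qz.
have := prox_ineq Q_convex (d_differentiable Qu) c_gt0 minu Qv.
move: acc; rewrite /accepted !dotpBl !dotpBr !mulrBr.
by lra.
Qed.

Section Trajectory.
Context {x y Lc} {N : nat} {M : R} (Qx0 : Q (x 0%N)) (L0_gt0 : 0 < Lc 0%N)
  (iter_xy : forall k, (k < N)%N ->
     apm_iteration Q d g (x k) (Lc k) (y k.+1) (x k.+1) (Lc k.+1)).

Lemma trajectory_inv k : (k <= N)%N -> Q (x k) /\ 0 < Lc k.
Proof.
elim: k => [//|k IHk] lt_kN; have [Qxk Lk_gt0] := IHk (ltnW lt_kN).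
by have [] := apm_iterationP Qxk Lk_gt0 (iter_xy lt_kN).
Qed.

Lemma trajectory_const_le k :
  Lc 0%N <= M -> 2 * L <= M -> (k <= N)%N -> Lc k <= M.
Proof.
move=> L0M LM; elim: k => [//|k IHk] lt_kN.
have [Qxk Lk_gt0] := trajectory_inv (ltnW lt_kN).
have := IHk (ltnW lt_kN).
by have [_ _ [->|]] := apm_iterationP Qxk Lk_gt0 (iter_xy lt_kN); lra.
Qed.

Lemma inv_sum_ge k : Lc 0%N <= M -> 2 * L <= M -> (k <= N)%N ->
  k%:R / M <= inv_sum Lc k.
Proof.
move=> L0M LM le_kN.
have -> : k%:R / M = \sum_(i < k) M^-1 by rewrite sumr_const card_ord mulr_natl.
apply: ler_sum => i _; have lt_iN := leq_trans (ltn_ord i) le_kN.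
have [_ Li_gt0] := trajectory_inv lt_iN.
have LiM := trajectory_const_le L0M LM lt_iN.
by rewrite lef_pV2 ?posrE// (lt_le_trans Li_gt0).
Qed.

Lemma regret_le z k : Q z -> (k <= N)%N ->
  \sum_(i < k) (Lc i.+1)^-1 * dotp (g (y i.+1)) (y i.+1 - z) <=
  bregman d z (x 0%N) - bregman d z (x k).
Proof.
move=> Qz; elim: k => [|k IHk] lt_kN; first by rewrite big_ord0 subrr.
have [Qxk Lk_gt0] := trajectory_inv (ltnW lt_kN).
rewrite big_ord_recr /=.
have := apm_iteration_ineq Qxk Lk_gt0 (iter_xy lt_kN) Qz.
by have := IHk (ltnW lt_kN); lra.
Qed.

End Trajectory.

Lemma infinite_trajectory_exists (x0 : 'rV[R]_n) (L0 : R) : Q x0 -> 0 < L0 ->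
  exists x y Lc, [/\ x 0%N = x0, Lc 0%N = L0 &
    forall k, apm_iteration Q d g (x k) (Lc k) (y k.+1) (x k.+1) (Lc k.+1)].
Proof.
move=> Qx0 L0_gt0.
have next (s : 'rV[R]_n * 'rV[R]_n * R) : exists s' : 'rV[R]_n * 'rV[R]_n * R,
    Q s.1.2 -> 0 < s.2 -> apm_iteration Q d g s.1.2 s.2 s'.1.1 s'.1.2 s'.2.
  have [[Qs s_gt0]|nQs] := pselect (Q s.1.2 /\ 0 < s.2); last first.
    by exists s => Qs s_gt0; case: nQs.
  have [u [v [c it]]] := apm_iteration_exists Qs s_gt0.
  by exists (u, v, c).
have [F FP] := choice next.
pose s k := iter k F (x0, x0, L0).
have inv k : Q (s k).1.2 /\ 0 < (s k).2.
  elim: k => [//|k [Qk Lk_gt0]].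
  by have [] := apm_iterationP Qk Lk_gt0 (FP _ Qk Lk_gt0).
exists (fun k => (s k).1.2), (fun k => (s k).1.1), (fun k => (s k).2).
by split => // k; have [Qk Lk_gt0] := inv k; exact: FP.
Qed.

(** * Complete runs *)

Lemma apm_complete_run_exists (eps L0 : R) (x0 : 'rV[R]_n) (R2 : R) :
  0 < eps -> 0 < L0 -> 0 <= R2 -> Q x0 ->
  exists N x y Lc, apm_complete_run Q d g eps L0 x0 R2 N x y Lc.
Proof.
move=> eps_gt0 L0_gt0 R2_ge0 Qx0.
have [x [y [Lc [xE LE iter]]]] := infinite_trajectory_exists Qx0 L0_gt0.
rewrite -xE in Qx0; rewrite -LE in L0_gt0.
pose M := Num.max (Lc 0%N) (2 * L).
have M_gt0 : 0 < M by rewrite lt_max L0_gt0.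
have ex_stop : exists N, R2 / eps <= inv_sum Lc N.
  exists (Num.bound (R2 / eps * M)).
  apply: le_trans
    (inv_sum_ge (M := M) Qx0 L0_gt0 (fun k _ => iter k) _ _ (leqnn _)).
  - rewrite ler_pdivlMr//; apply: ltW; apply: archi_boundP.
    by rewrite mulr_ge0 ?divr_ge0// ltW.
  - by rewrite le_max lexx.
  - by rewrite le_max lexx orbT.
case: (ex_minnP ex_stop) => N stopN minN.
exists N, x, y, Lc; split => //; split => // k lt_kN.
by rewrite ltNge; apply/negP => /minN; rewrite leqNgt lt_kN.
Qed.

(** The criterion was not met one iteration before the end, so
    [(N - 1) / (2 L) <= inv_sum Lc (N - 1) < R2 / eps]. *)
Lemma apm_run_length_le (eps L0 : R) (x0 : 'rV[R]_n) (R2 : R) N x y Lc :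
  0 < eps -> 0 < L0 -> 0 <= R2 -> Q x0 -> L0 <= 2 * L ->
  apm_run Q d g eps L0 x0 R2 N x y Lc ->
  N%:Z <= Num.ceil (2 * L * R2 / eps).
Proof.
move=> eps_gt0 L0_gt0 R2_ge0 Qx0 L0_le [xE LE iter run_on].
have L_gt0 : 0 < L by lra.
rewrite -xE in Qx0; rewrite -LE in L0_gt0 L0_le.
case: N iter run_on => [_ _|N iter run_on].
  rewrite ceil_ge0; apply: lt_le_trans (_ : 0 <= _); first by rewrite ltrN10.
  by rewrite divr_ge0 ?mulr_ge0// ltW.
rewrite -[N.+1]addn1 PoszD lezD1 ceil_gt_int.
have := le_lt_trans (inv_sum_ge Qx0 L0_gt0 iter L0_le (lexx _) (leqnSn N))
  (run_on N (ltnSn N)).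
by rewrite ltr_pdivrMr ?mulr_gt0// mulrC mulrA.
Qed.

Lemma apm_complete_run_gap_le (eps L0 : R) (x0 : 'rV[R]_n) (R2 : R) N x y Lc :
  0 < eps -> 0 < L0 -> Q x0 -> (forall z, Q z -> bregman d z x0 <= R2) ->
  apm_complete_run Q d g eps L0 x0 R2 N x y Lc -> (0 < N)%N ->
  exists M1 M2 : R,
    [/\ is_max_on Q (fun z =>
          min_below N (fun k => dotp (g (y k.+1)) (y k.+1 - z))) M1,
        is_max_on Q (fun z =>
          \sum_(k < N) (Lc k.+1)^-1 * dotp (g (y k.+1)) (y k.+1 - z)) M2,
        M1 <= (inv_sum Lc N)^-1 * M2 &
        (inv_sum Lc N)^-1 * M2 <= eps].
Proof.
move=> eps_gt0 L0_gt0 Qx0 V_le_R2 [[xE LE iter _] stop] N_gt0.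
have Q0 : Q !=set0 by exists x0.
rewrite -xE in Qx0 V_le_R2; rewrite -LE in L0_gt0.
have inv := trajectory_inv Qx0 L0_gt0 iter.
pose f k z := dotp (g (y k.+1)) (y k.+1 - z).
have df k z : differentiable (f k) z by exact: differentiable_dotpB.
have cf k : continuous (f k).
  by move=> z; apply: differentiable_continuous; exact: df.
have S_gt0 : 0 < inv_sum Lc N.
  case: N N_gt0 {stop} iter inv => // N _ _ inv.
  rewrite /inv_sum big_ord_recr /=; apply: ltr_wpDl.
    by apply: sumr_ge0 => i _; rewrite invr_ge0 ltW//; have [] := inv i.+1 (leqW (ltn_ord i)).
  by rewrite invr_gt0; have [] := inv N.+1 (leqnn _).
have [M1 M1max] := max_exists Q0 Q_compact (continuous_min_below (N := N) cf).
have [M2 M2max] : exists M2, is_max_on Q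
    (fun z => \sum_(k < N) (Lc k.+1)^-1 * f k z) M2.
  apply: max_exists => // z.
  apply: differentiable_continuous.
  rewrite (_ : (fun z => _) = \sum_(k < N) ((Lc k.+1)^-1 *: f k)).
    by apply: differentiable_sum => k; apply: differentiableZ; exact: df.
  by apply/funext => w; rewrite fct_sumE.
exists M1, M2; split => //.
  case: M1max => -[z Qz <-] _; rewrite ler_pdivlMl//.
  case: M2max => _ M2_ub; apply: le_trans (M2_ub _ (imageP _ Qz)).
  rewrite /inv_sum mulr_suml; apply: ler_sum => k _.
  have [_ Lk_gt0] := inv k.+1 (ltn_ord k).
  by rewrite ler_pM2l ?invr_gt0//; apply: (bigmin_le _ k).
case: M2max => -[z Qz <-] _; rewrite ler_pdivrMl//.
apply: (@le_trans _ _ R2); last by rewrite -ler_pdivrMr.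
apply: le_trans (regret_le Qx0 L0_gt0 iter Qz (leqnn N)) _.
have QxN : Q (x N) by have [] := inv N (leqnn N).
have := bregman_ge0 Qz QxN.
by have := V_le_R2 z Qz; lra.
Qed.

End Method.

Theorem mainTheorem2 (R : realType) (n : nat) (nu : 'rV[R]_n -> R)
    (Q : set 'rV[R]_n) (d : 'rV[R]_n -> R) (g : 'rV[R]_n -> 'rV[R]_n)
    (L eps L0 : R) (x0 : 'rV[R]_n) (R2 : R)
    (nu_norm : is_norm nu)
    (Q_convex : convex_set Q) (Q_compact : compact Q)
    (d_strongly_convex : strongly_convex 1 nu Q d)
    (d_differentiable : forall x, Q x -> differentiable d x)
    (g_lipschitz : forall x y, Q x -> Q y ->
       dual_norm nu (g x - g y) <= L * nu (x - y))
    (eps_gt0 : 0 < eps) (L0_gt0 : 0 < L0)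
    (x0_argmin : is_argmin_on Q d x0)
    (R2_max : is_max_on Q (fun x => bregman d x x0) R2) :
  (exists N x y Lc, apm_complete_run Q d g eps L0 x0 R2 N x y Lc) /\
  (L0 <= 2 * L ->
    (forall N x y Lc, apm_run Q d g eps L0 x0 R2 N x y Lc ->
       N%:Z <= Num.ceil (2 * L * R2 / eps)) /\
    (forall N x y Lc, apm_complete_run Q d g eps L0 x0 R2 N x y Lc ->
       (0 < N)%N ->
       exists M1 M2 : R,
         [/\ is_max_on Q (fun z =>
               min_below N (fun k => dotp (g (y k.+1)) (y k.+1 - z))) M1,
             is_max_on Q (fun z =>
               \sum_(k < N) (Lc k.+1)^-1 * dotp (g (y k.+1)) (y k.+1 - z)) M2,
             M1 <= (inv_sum Lc N)^-1 * M2 &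
             (inv_sum Lc N)^-1 * M2 <= eps])).
Proof.
have Qx0 : Q x0 by case: x0_argmin.
have V_le_R2 z : Q z -> bregman d z x0 <= R2.
  by move=> Qz; case: R2_max => _; apply; exists z.
have R2_ge0 : 0 <= R2.
  apply: le_trans (V_le_R2 _ Qx0).
  exact: (bregman_ge0 d_strongly_convex d_differentiable).
split.
  exact: (apm_complete_run_exists nu_norm Q_compact d_strongly_convex
    d_differentiable g_lipschitz).
move=> L0_le; split => N x y Lc run.
  exact: (apm_run_length_le nu_norm d_strongly_convex d_differentiable
    g_lipschitz eps_gt0 L0_gt0 R2_ge0 Qx0 L0_le run).
exact: (apm_complete_run_gap_le nu_norm Q_convex Q_compact d_strongly_convex
  d_differentiable g_lipschitz eps_gt0 L0_gt0 Qx0 V_le_R2 run).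
Qed.
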